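(* Let $M=(V,D)$ be a $\Delta$-matroid and $u\in V$. If $M$ is divisible by $u$, then $q_1(M)=q_1(M\setminus u)+q_1(M*u\setminus u)$. If $M$ is not divisible, then $q_1(M)=(y+1)^n$ where $n=|V|$.
   Context: A set system is $M=(V,D)$ with $V$ finite, $D$ a family of subsets of $V$; write $Z\in M$ for $Z\in D$; it is proper if $D\neq\emptyset$. $\oplus$ is symmetric difference. $M*X=(V,\{Z\oplus X:Z\in D\})$; $M\setminus u=(V\setminus\{u\},\{Z\in D:u\notin Z\})$; operations apply left to right, so $M*u\setminus u=(M*u)\setminus u$. For proper $M$, $d_M(X)=\min\{|X\oplus Z|:Z\in M\}$, $d_M=d_M(\emptyset)$, and $q_1(M)=\sum_{X\subseteq V}y^{d_{M*X}}$. A $\Delta$-matroid is a proper set system such that for all $X,Y\in M$ and all $w\in X\oplus Y$, either $X\oplus\{w\}\in M$ or there is $v\in X\oplus Y$, $v\neq w$, with $X\oplus\{w,v\}\in M$. $M$ is divisible by $u$ if there are $X_1,X_2\in M$ with $u\in X_1\oplus X_2$; $M$ is divisible if it is divisible by some $u\in V$. *)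

(* Defs.v *)
From HB Require Import structures.
From mathcomp Require Import all_boot all_order all_algebra.

Set Implicit Arguments.
Unset Strict Implicit.
Unset Printing Implicit Defensive.

Import GRing.Theory.

Section SymDiff.
Variable T : finType.
Implicit Types X Y Z : {set T}.

Definition symdiff X Y : {set T} := (X :\: Y) :|: (Y :\: X).

Lemma in_symdiff X Y x : (x \in symdiff X Y) = (x \in X) (+) (x \in Y).
Proof. by rewrite !inE; case: (x \in X); case: (x \in Y). Qed.

End SymDiff.

(* The ground set V is an arbitrary finite subset of the ambient type T, so
   that deleting an element stays within the same type. *)
Record set_system (T : finType) := SetSystem {
  ground : {set T};
  feasible : {set {set T}};
  feasible_sub : feasible \subset powerset ground
}.

Section SetSystem.
Variable T : finType.
Implicit Types (M : set_system T) (X Y Z : {set T}) (u v w : T).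

Definition proper_system M : Prop := feasible M != set0.

Fact twist_sub M X :
  [set symdiff Z X | Z in feasible M] \subset powerset (ground M :|: X).
Proof.
apply/subsetP=> _ /imsetP[Z MZ ->]; rewrite powersetE.
have := subsetP (feasible_sub M) Z MZ; rewrite powersetE => /subsetP sZV.
apply/subsetP=> x; rewrite !inE.
by case/orP=> /andP[_]; [move/sZV-> | move=> ->; rewrite orbT].
Qed.

(* M * X. The operation is meant for X \subset V, in which case the ground set
   V :|: X is V; the union only makes the operation total. *)
Definition twist M X : set_system T := SetSystem (twist_sub M X).

Fact delete_sub M u :
  [set Z in feasible M | u \notin Z] \subset powerset (ground M :\ u).
Proof.
apply/subsetP=> Z; rewrite inE powersetE => /andP[MZ uZ].
by rewrite subsetD1 uZ andbT -powersetE (subsetP (feasible_sub M)).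
Qed.

Definition delete M u : set_system T := SetSystem (delete_sub M u).

(* d_M(X). The neutral element #|T| is an upper bound of all the terms, so for
   proper M this is the true minimum (see distP); it is a junk value
   otherwise. *)
Definition dist M X : nat := \big[minn/#|T|]_(Z in feasible M) #|symdiff X Z|.

Lemma distP M X : proper_system M ->
  (exists2 Z, Z \in feasible M & dist M X = #|symdiff X Z|) /\
  (forall Z, Z \in feasible M -> dist M X <= #|symdiff X Z|).
Proof.
move=> /set0Pn[Z0 MZ0].
have le_d Z : Z \in feasible M -> dist M X <= #|symdiff X Z|.
  move=> MZ; rewrite /dist; elim: (index_enum _) (mem_index_enum Z) => // Y s IHs.
  rewrite big_cons inE => /predU1P[<-|/IHs le_s]; first by rewrite MZ geq_minl.
  by case: ifP => // _; apply: leq_trans (geq_minr _ _) le_s.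
split=> //.
have [//|dT] : (exists2 Z, Z \in feasible M & dist M X = #|symdiff X Z|)
               \/ dist M X = #|T|.
  rewrite /dist; apply: (big_ind (fun d =>
    (exists2 Z, Z \in feasible M & d = #|symdiff X Z|) \/ d = #|T|)).
  - by right.
  - by move=> a b Ha Hb; rewrite /minn; case: ifP.
  - by move=> Z MZ; left; exists Z.
exists Z0 => //; apply/eqP; rewrite eqn_leq le_d //= dT.
exact: max_card.
Qed.

(* The polynomial q_1(M), with y rendered as 'X. *)
Definition q1 M : {poly int} :=
  (\sum_(X in powerset (ground M)) 'X^(dist (twist M X) set0))%R.

Definition delta_matroid M : Prop :=
  proper_system M /\
  forall X Y w, X \in feasible M -> Y \in feasible M -> w \in symdiff X Y ->
    symdiff X [set w] \in feasible M \/
    exists v, [/\ v \in symdiff X Y, v != w &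
                  symdiff X [set w; v] \in feasible M].

Definition divisible_by M u : Prop :=
  exists X1 X2, [/\ X1 \in feasible M, X2 \in feasible M & u \in symdiff X1 X2].

Definition divisible M : Prop := exists2 u, u \in ground M & divisible_by M u.

End SetSystem.

(* Main.v *)
Require Import Defs.
From HB Require Import structures.
From mathcomp Require Import all_boot all_order all_algebra.

Set Implicit Arguments.
Unset Strict Implicit.
Unset Printing Implicit Defensive.

Import GRing.Theory.
Local Open Scope ring_scope.

(* By twisting, q_1(M) is the sum of y^{d_M(X)} over X \subset V. If M is
   divisible by u, the exchange axiom at u modifies a feasible set nearest to X
   into one that is still nearest and agrees with X on u; hence d_M(X) is
   computed in M \ u when u is not in X, and in M * u \ u otherwise. If M is
   not divisible, it has a single feasible set Z, and d_M(X) = |X (+) Z|. *)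

Section SymDiffTheory.
Variable T : finType.
Implicit Types X Y Z : {set T}.

Lemma symdiffA : associative (@symdiff T).
Proof. by move=> X Y Z; apply/setP=> x; rewrite !in_symdiff addbA. Qed.

Lemma symdiffC : commutative (@symdiff T).
Proof. by move=> X Y; apply/setP=> x; rewrite !in_symdiff addbC. Qed.

Lemma symdiffK Z : involutive (@symdiff T ^~ Z).
Proof. by move=> X; apply/setP=> x; rewrite !in_symdiff addbK. Qed.

Lemma symdiff_subset X Y Z : X \subset Z -> Y \subset Z -> symdiff X Y \subset Z.
Proof. by move=> XZ YZ; rewrite subUset !subDset !subsetU ?XZ ?YZ ?orbT. Qed.

Lemma symdiff_eq X Y : symdiff X Y = set0 -> X = Y.
Proof.
move/setP=> XY; apply/setP=> x; have := XY x; rewrite in_symdiff inE.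
by case: (x \in X) (x \in Y) => [] [].
Qed.

Lemma card_symdiff_set1 X u : u \in X -> #|symdiff X [set u]|.+1 = #|X|.
Proof.
move=> uX; rewrite (cardsD1 u X) uX add1n; congr _.+1; apply: eq_card => x.
by rewrite in_symdiff !inE; case: eqP => [->|]; rewrite ?uX ?addbF.
Qed.

(** Toggling [u] removes one element, and toggling [v] adds at most one back. *)
Lemma leq_card_symdiff_set2 X u v :
  u \in X -> (#|symdiff X [set u; v]| <= #|X|)%N.
Proof.
move=> uX; rewrite (cardsD1 u X) uX.
have /subset_leq_card : symdiff X [set u; v] \subset v |: (X :\ u).
  apply/subsetP=> x; rewrite in_symdiff !inE.
  by case: (x =P u) => [->|_]; rewrite ?uX //=; case: (x == v); rewrite ?addbF.
by move/leq_trans; apply; rewrite cardsU1; case: (v \notin _).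
Qed.

End SymDiffTheory.

Section Distance.
Variable T : finType.
Implicit Types (M : set_system T) (X Y Z : {set T}) (u v : T).

Lemma dist_eq M X Z : Z \in feasible M ->
    (forall Y, Y \in feasible M -> (#|symdiff X Z| <= #|symdiff X Y|)%N) ->
  dist M X = #|symdiff X Z|.
Proof.
move=> MZ Zmin; have Mproper : proper_system M by apply/set0Pn; exists Z.
have [[Y MY dY] dmin] := distP X Mproper.
by apply/eqP; rewrite eqn_leq dmin //= dY Zmin.
Qed.

(** Twisting translates distances, since $Y \oplus (W \oplus X) = (Y \oplus X) \oplus W$ for each
    feasible [W]. *)
Lemma dist_twist M X Y :
  proper_system M -> dist (twist M X) Y = dist M (symdiff Y X).
Proof.
move=> Mproper; have [[Z MZ dZ] dmin] := distP (symdiff Y X) Mproper.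
have E W : symdiff Y (symdiff W X) = symdiff (symdiff Y X) W.
  by rewrite -symdiffA (symdiffC W).
rewrite dZ -E; apply: dist_eq => [|_ /imsetP[W MW ->]]; first exact: imset_f.
by rewrite !E -dZ dmin.
Qed.

Lemma q1E M : proper_system M ->
  q1 M = \sum_(X in powerset (ground M)) 'X^(dist M X).
Proof.
move=> Mproper; apply: eq_bigr => X _; rewrite dist_twist //.
by congr ('X^(dist M _)); apply/setP=> x; rewrite in_symdiff inE.
Qed.

Lemma nearest_feasible_agree M X u : delta_matroid M -> divisible_by M u ->
  exists Z, [/\ Z \in feasible M, dist M X = #|symdiff X Z| &
                (u \in Z) = (u \in X)].
Proof.
move=> [Mproper Mexch] [X1 [X2 [MX1 MX2]]]; rewrite in_symdiff => uX12.
have [[Z MZ dZ] dmin] := distP X Mproper.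
have [uXZ|] := boolP (u \in symdiff X Z); last first.
  rewrite in_symdiff => uXZ; exists Z; split=> //.
  by case: (u \in X) (u \in Z) uXZ => [] [].
(* As [X1] and [X2] differ at [u], one of them differs from [Z] there and can serve in the exchange
   axiom. *)
have [Y MY uZY] : exists2 Y, Y \in feasible M & u \in symdiff Z Y.
  have [uZX1|uZX1] := boolP (u \in symdiff Z X1); first by exists X1.
  exists X2 => //; move: uZX1 uX12; rewrite !in_symdiff.
  by case: (u \in Z) (u \in X1) (u \in X2) => [] [] [].
(* Toggling [u] alone would bring [Z] strictly closer to [X], against minimality. Toggling [u] and
   [v] brings it no farther, so the new set is again nearest. *)
have [MZu|[v [_ vu MZuv]]] := Mexch Z Y u MZ MY uZY.
  by have := dmin _ MZu; rewrite dZ symdiffA -(card_symdiff_set1 uXZ) ltnn.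
exists (symdiff Z [set u; v]); split=> //.
  by apply/eqP; rewrite eqn_leq dmin //= dZ symdiffA leq_card_symdiff_set2.
move: uXZ; rewrite !in_symdiff !inE eqxx.
by case: (u \in X) (u \in Z) => [] [].
Qed.

(** Some nearest feasible set avoids [u] as [X] does, so it survives the deletion; the remaining
    sets were already competitors in [M]. *)
Lemma dist_delete M X u : delta_matroid M -> divisible_by M u -> u \notin X ->
  dist (delete M u) X = dist M X.
Proof.
move=> hM Mu uX; have [Z [MZ dZ uZ]] := nearest_feasible_agree X hM Mu.
rewrite dZ; apply: dist_eq => [|Y]; rewrite inE ?MZ ?uZ // => /andP[MY _].
by have [_ dmin] := distP X hM.1; rewrite -dZ dmin.
Qed.

Lemma symdiff_twist X Y Z : symdiff (symdiff Y X) (symdiff Z X) = symdiff Y Z.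
Proof. by rewrite [symdiff Z X]symdiffC symdiffA symdiffK. Qed.

(** Twisting preserves the symmetric difference of two feasible sets and commutes with toggling
    elements, so exchanges carry over. *)
Lemma delta_matroid_twist M X : delta_matroid M -> delta_matroid (twist M X).
Proof.
move=> [/set0Pn[Z MZ] Mexch]; split.
  by apply/set0Pn; exists (symdiff Z X); apply: imset_f.
have E A B : symdiff (symdiff A X) B = symdiff (symdiff A B) X.
  by rewrite -!symdiffA (symdiffC X).
move=> _ _ w /imsetP[A MA ->] /imsetP[B MB ->]; rewrite symdiff_twist => wAB.
have [MAw|[v [vAB vw MAwv]]] := Mexch A B w MA MB wAB.
  by left; rewrite E; apply: imset_f.
by right; exists v; split; rewrite ?symdiff_twist // E; apply: imset_f.
Qed.

Lemma divisible_by_twist M X u : divisible_by M u -> divisible_by (twist M X) u.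
Proof.
move=> [X1 [X2 [MX1 MX2 uX]]]; exists (symdiff X1 X), (symdiff X2 X).
by split; rewrite ?symdiff_twist //; apply: imset_f.
Qed.

Lemma q1_delete M u : delta_matroid M -> divisible_by M u ->
  q1 (delete M u) = \sum_(X in powerset (ground M :\ u)) 'X^(dist M X).
Proof.
move=> hM Mu; rewrite q1E; last first.
  (* Agreement with the empty set at [u] yields a feasible set avoiding [u], so the deletion is
     proper. *)
  have [Z [MZ _ uZ]] := nearest_feasible_agree set0 hM Mu.
  by apply/set0Pn; exists Z; rewrite inE MZ uZ inE.
apply: eq_bigr => X; rewrite powersetE subsetD1 => /andP[_ uX].
by rewrite dist_delete.
Qed.

(** An element on which two feasible sets differ lies in the ground set and would divide [M]. *)
Lemma not_divisible_feasible1 M :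
  proper_system M -> ~ divisible M -> exists Z, feasible M = [set Z].
Proof.
move=> /set0Pn[Z MZ] ndivM; exists Z; apply/setP=> Y; rewrite inE.
apply/idP/eqP=> [MY|->//]; apply: symdiff_eq; apply/setP=> u; rewrite in_set0.
apply/negP=> uYZ; apply: ndivM; exists u; last by exists Y, Z.
have sV W : W \in feasible M -> W \subset ground M.
  by rewrite -powersetE; apply: (subsetP (feasible_sub M)).
by apply: subsetP uYZ; apply: symdiff_subset; apply: sV.
Qed.

End Distance.

Lemma big_powersetD1 (V : nmodType) (T : finType) (A : {set T}) (u : T)
    (F : {set T} -> V) : u \in A ->
  \sum_(X in powerset A) F X =
    \sum_(X in powerset (A :\ u)) F X + \sum_(X in powerset (A :\ u)) F (u |: X).
Proof.
move=> uA; rewrite (bigID (fun X : {set T} => u \in X)) /= addrC; congr (_ + _).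
  by apply: eq_bigl => X; rewrite !powersetE subsetD1.
rewrite (reindex_onto (fun X => u |: X) (fun X => X :\ u)) /=; last first.
  by move=> X /andP[_ uX]; rewrite setD1K.
apply: eq_bigl => X; rewrite !powersetE subUset sub1set uA setU11 andbT subsetD1.
congr (_ && _); apply/eqP/idP=> [<-|uX]; first by rewrite setD11.
by rewrite setU1K.
Qed.

(** Each element of [A] contributes a factor [1] when left out of the subset and ['X] when put
    in. *)
Lemma sum_powerset_Xn_card (R : comNzRingType) (T : finType) (A : {set T}) :
  \sum_(X in powerset A) 'X^#|X| = ('X + 1) ^+ #|A| :> {poly R}.
Proof.
have [n] := ubnP #|A|; elim: n A => // n IHn A leAn.
have [->|[u uA]] := set_0Vmem A; first by rewrite powerset0 big_set1 !cards0.
rewrite (big_powersetD1 _ uA) (cardsD1 u A) uA exprS mulrDl mul1r addrC.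
rewrite -IHn; last by move: leAn; rewrite (cardsD1 u A) uA.
congr (_ + _); rewrite mulr_sumr; apply: eq_bigr => X.
by rewrite powersetE subsetD1 => /andP[_ uX]; rewrite cardsU1 uX exprS.
Qed.

Theorem theorem16 (T : finType) (M : set_system T) (hM : delta_matroid M) :
  (forall u : T, u \in ground M -> divisible_by M u ->
     q1 M = q1 (delete M u) + q1 (delete (twist M [set u]) u)) /\
  (~ divisible M -> q1 M = ('X + 1) ^+ #|ground M|).
Proof.
split=> [u uV Mu | ndivM].
  rewrite q1E ?(big_powersetD1 _ uV); last exact: hM.1.
  rewrite !q1_delete //; try exact: delta_matroid_twist;
    try exact: divisible_by_twist.
  (* Since [u] is in the ground set, twisting by [[set u]] leaves that set unchanged, and the second
     sums have the same range. They agree termwise because $X \oplus \{u\} = X \cup \{u\}$ when [u]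
     is not in [X]. *)
  congr (_ + _); rewrite /= setUC (setUidPr _) ?sub1set //.
  apply: eq_bigr => X; rewrite powersetE subsetD1 => /andP[_ uX].
  rewrite dist_twist; last exact: hM.1.
  congr ('X^(dist M _)); apply/setP=> x; rewrite in_symdiff !inE addbC.
  by case: eqP => [->|]; rewrite ?(negPf uX).
have [Z MZ] := not_divisible_feasible1 hM.1 ndivM.
have sZV : Z \subset ground M.
  by rewrite -powersetE (subsetP (feasible_sub M)) ?MZ ?set11.
rewrite q1E -?sum_powerset_Xn_card; last exact: hM.1.
(* The involution $X \mapsto X \oplus Z$ permutes the subsets of the ground set, as it contains [Z],
   and turns cardinality into distance to [Z]. *)
rewrite [RHS](reindex_inj (inv_inj (symdiffK Z))) /=.
apply: eq_big => [X|X _]; last first.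
  by rewrite (@dist_eq _ M X Z) ?MZ ?set11 // => Y; rewrite inE => /eqP ->.
rewrite !powersetE; apply/idP/idP=> sV; first exact: symdiff_subset.
by rewrite -(symdiffK Z X) symdiff_subset.
Qed.
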